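(* Let $z\in\mathcal D(M)$ solve $$(M+N)z=g .$$ Then the concatenation $\begin{pmatrix}x\\ \lambda\end{pmatrix}=\mathcal Cz$ satisfies $$(x,\lambda)\in \big(H^1([0,T];X)\cap L^2([0,T];\mathcal D(A))\big)\times\big(H^1([0,T];X)\cap L^2([0,T];\mathcal D(A^* ))\big)$$ and solves the optimality system $$\dot x(t)=Ax(t)+BB^*\lambda(t),\quad x(0)=x_0,\qquad \dot\lambda(t)=-A^*\lambda(t)+C^*Cx(t)-C^*y_{\mathrm{ref}}(t),\quad \lambda(T)=0,$$ in the weak sense. Conversely, if a pair $(x,\lambda)$ solves this optimality system in the weak sense, then there are unique $v_{1,x},\dots,v_{K,x},v_{1,\lambda},\dots,v_{K,\lambda}\in X$ such that $$z=\left(\begin{pmatrix}x|_{[t_0,t_1]}\\ \lambda|_{[t_0,t_1]}\\ v_{1,x}\\ v_{1,\lambda}\end{pmatrix},\dots,\begin{pmatrix}x|_{[t_{K-1},t_K]}\\ \lambda|_{[t_{K-1},t_K]}\\ v_{K,x}\\ v_{K,\lambda}\end{pmatrix}\right)\in\mathcal D(M)$$ solves $(M+N)z=g$.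
   Context: Setting. $X,U,Y$ are Hilbert spaces (identified with their duals), $A:\mathcal D(A)\subset X\to X$ generates a $C_0$-semigroup on $X$, $B\in\mathcal L(U,X)$, $C\in\mathcal L(X,Y)$, $T>0$, $y_{\mathrm{ref}}\in L^2([0,T];Y)$, $x_0\in X$. Time grid: $0=t_0<t_1<\dots<t_K=T$, with $K\ge2$. A pair $(x,\lambda)$ is a weak solution of the optimality system if $x\in H^1([0,T];X)\cap L^2([0,T];\mathcal D(A))$, $\lambda\in H^1([0,T];X)\cap L^2([0,T];\mathcal D(A^* ))$, the differential equations hold pointwise almost everywhere and the boundary conditions hold. Spaces. For $\ell<r$, $\mathcal A^\ell_{[\ell,r]}:=\{f+c\,\delta_\ell\mid f\in L^2([\ell,r];X),\,c\in X\}$ is a notation for the Hilbert space $L^2([\ell,r];X)\times X$ with inner product $\langle f_1+c_1\delta_\ell,f_2+c_2\delta_\ell\rangle=\langle f_1,f_2\rangle_{L^2}+\langle c_1,c_2\rangle_X$; $\mathcal A^r_{[\ell,r]}=\{f+c\,\delta_r\}$ is defined analogously. Functions in $H^1([\ell,r];X)$ are embedded into $\mathcal A^\ell_{[\ell,r]}$ via $x\mapsto x+x(\ell)\delta_\ell$ and into $\mathcal A^r_{[\ell,r]}$ via $x\mapsto x+x(r)\delta_r$. Set $Z_k:=\mathcal A^{t_k}_{[t_{k-1},t_k]}\times\mathcal A^{t_{k-1}}_{[t_{k-1},t_k]}\times X^2$ and $Z:=Z_1\times\dots\times Z_K$. Operator $M$. For $\ell<r$ let $\mathcal D(M_{[\ell,r]}):=\big(H^1([\ell,r];X)\cap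 L^2([\ell,r];\mathcal D(A))\big)\times\big(H^1([\ell,r];X)\cap L^2([\ell,r];\mathcal D(A^* ))\big)\times X^2$, viewed as a subspace of $\mathcal A^r_{[\ell,r]}\times\mathcal A^\ell_{[\ell,r]}\times X^2$ through the embeddings $x\mapsto x+x(r)\delta_r$ of the first component into $\mathcal A^r_{[\ell,r]}$ and $\lambda\mapsto\lambda+\lambda(\ell)\delta_\ell$ of the second component into $\mathcal A^\ell_{[\ell,r]}$, and $$M_{[\ell,r]}\begin{pmatrix}x\\ \lambda\\ v_x\\ v_\lambda\end{pmatrix}=\begin{pmatrix}-C^*Cx+\dot\lambda+A^*\lambda-\lambda(r)\delta_r+v_\lambda\delta_r\\ \dot x-Ax+x(\ell)\delta_\ell-BB^*\lambda-v_x\delta_\ell\\ \lambda(\ell)\\ -x(r)\end{pmatrix}.$$ (On the right-hand side, $\dot\lambda$, $A^*\lambda$, $\dot x$, $Ax$ etc. are the $L^2$-parts and only the explicitly written $\delta$-terms are the point parts.) With the same domain on $[t_0,t_1]$ resp. $[t_{K-1},t_K]$, $$M_0\begin{pmatrix}x\\ \lambda\\ v_x\\ v_\lambda\end{pmatrix}=\begin{pmatrix}-C^*Cx+\dot\lambda+A^*\lambda-\lambda(t_1)\delta_{t_1}+v_\lambda\delta_{t_1}\\ \dot x-Ax+x(t_0)\delta_{t_0}-BB^*\lambda\\ 0\\ -x(t_1)\end{pmatrix},$$ $$M_T\begin{pmatrix}x\\ \lambda\\ v_x\\ v_\lambda\end{pmatrix}=\begin{pmatrix}-C^*Cx+\dot\lambda+A^*\lambda-\lambda(t_K)\delta_{t_K}\\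 \dot x-Ax+x(t_{K-1})\delta_{t_{K-1}}-BB^*\lambda-v_x\delta_{t_{K-1}}\\ \lambda(t_{K-1})\\ 0\end{pmatrix}.$$ $M:\mathcal D(M)\subset Z\to Z$ is the block-diagonal operator $M=\mathrm{diag}(M_0,M_{[t_1,t_2]},\dots,M_{[t_{K-2},t_{K-1}]},M_T)$ with $\mathcal D(M)=\mathcal D(M_{[t_0,t_1]})\times\dots\times\mathcal D(M_{[t_{K-1},t_K]})$. Operator $N\in\mathcal L(Z)$: for $z=(z_1,\dots,z_K)$ with $z_k=(x_k,\lambda_k,v_{k,x},v_{k,\lambda})$, the $k$-th component of $Nz$ is $(0,0,-v_{k-1,\lambda},v_{k+1,x})$, where the third entry is $0$ for $k=1$ and the fourth entry is $0$ for $k=K$. Right-hand side: $g=(g_1,\dots,g_K)\in Z$ with $g_1=(-C^*y_{\mathrm{ref}}|_{[t_0,t_1]},\,x_0\delta_{t_0},\,0,\,0)$ and $g_k=(-C^*y_{\mathrm{ref}}|_{[t_{k-1},t_k]},\,0,\,0,\,0)$ for $k\ge2$ (with no $\delta$-part in the first entry). Concatenation $\mathcal C\in\mathcal L(Z,L^2([0,T];X)^2)$: $\mathcal Cz=(x,\lambda)$ with $x(s)=x_k(s)$ for $s\in[t_{k-1},t_k)$, $x(T)=x_K(T)$, and likewise for $\lambda$ (using the function parts of the components).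
   Formalization: Uniqueness is asserted only for v_{k,x} with k≥2 and v_{k,λ} with k≤K−1; v_{1,x} and v_{K,λ} do not occur in (M+N)z=g, so their claimed uniqueness is false whenever X≠{0} and a weak solution exists. *)

(* Defs.v *)
From HB Require Import structures.
From mathcomp Require Export all_boot all_order all_algebra.
From mathcomp Require Export all_classical all_reals all_analysis.
Export Order.TTheory GRing.Theory Num.Theory numFieldNormedType.Exports.

Set Implicit Arguments.
Unset Strict Implicit.
Unset Printing Implicit Defensive.

Global Open Scope classical_set_scope.
Global Open Scope ring_scope.

(* Real Hilbert spaces. A complex Hilbert space is covered by restricting
   scalars and taking the real part of its inner product: norms, bounded
   operators, semigroup generators and adjoints of complex-linear operators are
   unchanged by this. *)
HB.mixin Record CompleteNormedModule_isHilbert (R : realType) V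
    of CompleteNormedModule R V := {
  inner : V -> V -> R ;
  innerC : forall x y, inner x y = inner y x ;
  innerDl : forall x y z, inner (x + y) z = inner x z + inner y z ;
  innerZl : forall a x y, inner (a *: x) y = a * inner x y ;
  inner_normE : forall x, inner x x = `|x| ^+ 2
}.

#[short(type="hilbertType")]
HB.structure Definition Hilbert (R : realType) :=
  {V of CompleteNormedModule R V & CompleteNormedModule_isHilbert R V}.

Section Operators.
Variable R : realType.

(* A partially defined operator; the values of [op_fun] off [op_dom] are junk. *)
Record operator (V W : Type) :=
  Operator { op_dom : set V ; op_fun :> V -> W }.

Definition is_adjoint_value (V W : hilbertType R) (A : operator V W) (y : W)
    (w : V) :=
  forall x, op_dom A x -> inner (A x) y = inner x w.

(* The vector [w] representing [y] is unique as soon as [A] is densely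
   defined, e.g. if [A] is everywhere defined or a semigroup generator. *)
Definition adjoint (V W : hilbertType R) (A : operator V W) : operator W V :=
  Operator [set y | exists w, is_adjoint_value A y w]
           (fun y => xget 0 (is_adjoint_value A y)).

Definition everywhere (V W : Type) (f : V -> W) : operator V W :=
  Operator setT f.

Definition is_C0_semigroup (V : completeNormedModType R) (S : R -> V -> V) :=
  [/\ forall s, 0 <= s -> linear (S s) /\ continuous (S s),
      forall x, S 0 x = x,
      forall s t x, 0 <= s -> 0 <= t -> S (s + t) x = S s (S t x) &
      forall x, S s x @[s --> 0^'+] --> x].

Definition is_generator (V : completeNormedModType R) (A : operator V V)
    (S : R -> V -> V) :=
  forall x,
    (op_dom A x <-> cvg (s^-1 *: (S s x - x) @[s --> 0^'+])) /\
    (op_dom A x -> s^-1 *: (S s x - x) @[s --> 0^'+] --> A x).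

Definition generates_C0_semigroup (V : completeNormedModType R)
    (A : operator V V) :=
  exists S, is_C0_semigroup S /\ is_generator A S.

Definition graph_norm (V W : normedModType R) (A : operator V W) (x : V) : R :=
  Num.sqrt (`|x| ^+ 2 + `|A x| ^+ 2).

End Operators.

Section FunctionSpaces.
Variables (R : realType) (V : completeNormedModType R).
Implicit Types (l r : R) (f : R -> V).

Local Notation mu := (@lebesgue_measure R).

Definition ae_on l r (P : R -> Prop) :=
  {ae mu, forall s, s \in `[l, r] -> P s}.

Definition simple_fun (s : R -> V) :=
  finite_set (range s) /\
  forall v, measurable (s @^-1` [set v] : set (measurableTypeR R)).

(* Bochner space L^2([l, r]; E), where E is the subspace [D] of [V] equipped
   with its own norm [nrm]: strong measurability in E is approximation a.e. by
   simple functions with values in E. Its elements are represented by functions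
   on the real line, compared a.e. on [l, r]. *)
Definition bochner_L2 (D : set V) (nrm : V -> R) l r f :=
  (exists s : nat -> R -> V,
     (forall n, simple_fun (s n) /\ range (s n) `<=` D) /\
     ae_on l r (fun t => D (f t) /\ nrm (s n t - f t) @[n --> \oo] --> 0)) /\
  (\int[mu]_(t in `[l, r]) ((nrm (f t)) ^+ 2)%:E < +oo)%E.

Definition L2 l r f := bochner_L2 setT (fun v => `|v|) l r f.

Definition L2_dom (W : normedModType R) (A : operator V W) l r f :=
  bochner_L2 (op_dom A) (graph_norm A) l r f.

Definition abs_continuous l r f :=
  forall e : R, 0 < e -> exists2 d : R, 0 < d &
    forall I : seq (R * R),
      all (fun p => (l <= p.1 <= p.2) && (p.2 <= r)) I ->
      pairwise (fun p q => p.2 <= q.1) I ->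
      \sum_(p <- I) (p.2 - p.1) < d ->
      \sum_(p <- I) `|f p.2 - f p.1| < e.

(* H^1([l, r]; V); an element is given by its absolutely continuous
   representative, so that its point values on [l, r] make sense. *)
Definition H1 l r f :=
  [/\ L2 l r f, abs_continuous l r f,
      ae_on l r (fun t => derivable f t 1) & L2 l r (derive1 f)].

End FunctionSpaces.

Section OptimalitySystem.
Variables (R : realType) (X U Y : hilbertType R).
Variables (A : operator X X) (B : U -> X) (C : X -> Y).
Variables (yref : R -> Y) (x0 : X).

Local Notation As := (adjoint A).
Local Notation Bs := (adjoint (everywhere B)).
Local Notation Cs := (adjoint (everywhere C)).

Definition weak_solution (T : R) (x lam : R -> X) :=
  [/\ H1 0 T x /\ L2_dom A 0 T x,
      H1 0 T lam /\ L2_dom As 0 T lam,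
      ae_on 0 T (fun s => derive1 x s = A (x s) + B (Bs (lam s))) /\ x 0 = x0 &
      ae_on 0 T (fun s => derive1 lam s =
                          - As (lam s) + Cs (C (x s)) - Cs (yref s)) /\
      lam T = 0].

(* (f, c) stands for f + c delta_a, with a an end point of the interval. *)
Definition Adelta : zmodType := ((R -> X) * X)%type.

Definition embed (a : R) (f : R -> X) : Adelta := (f, f a).

Definition Zblock : zmodType := (Adelta * Adelta * X * X)%type.

Definition fun_x (b : Zblock) : R -> X := b.1.1.1.1.
Definition fun_lam (b : Zblock) : R -> X := b.1.1.2.1.
Definition v_x (b : Zblock) : X := b.1.2.
Definition v_lam (b : Zblock) : X := b.2.

Definition mkZblock (l r : R) (x lam : R -> X) (vx vl : X) : Zblock :=
  (embed r x, embed l lam, vx, vl).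

Definition dom_block (l r : R) (b : Zblock) :=
  exists x lam vx vl,
    [/\ b = mkZblock l r x lam vx vl,
        H1 l r x /\ L2_dom A l r x & H1 l r lam /\ L2_dom As l r lam].

Definition block_eq (l r : R) (b b' : Zblock) :=
  [/\ ae_on l r (fun s => fun_x b s = fun_x b' s),
      b.1.1.1.2 = b'.1.1.1.2,
      ae_on l r (fun s => fun_lam b s = fun_lam b' s),
      b.1.1.2.2 = b'.1.1.2.2 &
      v_x b = v_x b' /\ v_lam b = v_lam b'].

Definition M_fun1 (b : Zblock) : R -> X := fun s =>
  - Cs (C (fun_x b s)) + derive1 (fun_lam b) s + As (fun_lam b s).

Definition M_fun2 (b : Zblock) : R -> X := fun s =>
  derive1 (fun_x b) s - A (fun_x b s) - B (Bs (fun_lam b s)).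

Definition M_mid (l r : R) (b : Zblock) : Zblock :=
  ((M_fun1 b, - fun_lam b r + v_lam b), (M_fun2 b, fun_x b l - v_x b),
   fun_lam b l, - fun_x b r).

Definition M_first (l r : R) (b : Zblock) : Zblock :=
  ((M_fun1 b, - fun_lam b r + v_lam b), (M_fun2 b, fun_x b l),
   0, - fun_x b r).

Definition M_last (l r : R) (b : Zblock) : Zblock :=
  ((M_fun1 b, - fun_lam b r), (M_fun2 b, fun_x b l - v_x b),
   fun_lam b l, 0).

(* Block [k : 'I_K] lives on [t k, t k.+1], i.e. indices are shifted by one;
   only the values t 0, ..., t K of the grid matter. *)
Variables (K : nat) (t : nat -> R).

Definition Zspace : zmodType := ('I_K -> Zblock).

Definition Z_eq (z z' : Zspace) :=
  forall k : 'I_K, block_eq (t k) (t k.+1) (z k) (z' k).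

Definition dom_M (z : Zspace) :=
  forall k : 'I_K, dom_block (t k) (t k.+1) (z k).

Definition M (z : Zspace) : Zspace := fun k =>
  if k == 0 :> nat then M_first (t k) (t k.+1) (z k)
  else if k.+1 == K then M_last (t k) (t k.+1) (z k)
  else M_mid (t k) (t k.+1) (z k).

Definition at_index (f : 'I_K -> X) (n : nat) : X := oapp f 0 (insub n).

Definition N (z : Zspace) : Zspace := fun k =>
  (0, 0,
   if k == 0 :> nat then 0 else - at_index (v_lam \o z) k.-1,
   at_index (v_x \o z) k.+1).

Definition rhs : Zspace := fun k =>
  ((fun s => - Cs (yref s), 0), (0, if k == 0 :> nat then x0 else 0), 0, 0).

Definition solves_MN (z : Zspace) := dom_M z /\ Z_eq (M z + N z) rhs.

Definition concat (f : Zblock -> R -> X) (z : Zspace) : R -> X := fun s =>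
  if [pick k : 'I_K | (t k <= s < t k.+1) || ((k.+1 == K) && (s == t K))]
    is Some k then f (z k) s else 0.

Definition restrict (x lam : R -> X) (vx vl : 'I_K -> X) : Zspace := fun k =>
  mkZblock (t k) (t k.+1) x lam (vx k) (vl k).

(* The first v_x and the last v_lam do not enter the equation (M + N) z = g:
   their columns in M + N vanish. *)
Lemma solves_MN_free (x lam : R -> X) (vx vl vx' vl' : 'I_K -> X) :
  (1 < K)%N ->
  (forall k : 'I_K, (0 < k)%N -> vx' k = vx k) ->
  (forall k : 'I_K, (k.+1 < K)%N -> vl' k = vl k) ->
  solves_MN (restrict x lam vx vl) -> solves_MN (restrict x lam vx' vl').
Proof.
move=> K1 hx hl [zM zE]; split.
  move=> k; have [x1 [l1 [v1 [w1 [[ex _ el _ _ _] ? ?]]]]] := zM k.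
  by exists x, lam, (vx' k), (vl' k); split=> //; rewrite ?ex ?el.
suff -> : M (restrict x lam vx' vl') + N (restrict x lam vx' vl') =
          M (restrict x lam vx vl) + N (restrict x lam vx vl) by [].
have eN : N (restrict x lam vx' vl') = N (restrict x lam vx vl).
  apply/funext => k; rewrite /N; congr (_, _, _, _).
    case: eqP => // /eqP k0; rewrite /at_index; case: insubP => //= j _ ej.
    by rewrite /v_lam /= hl // ej prednK ?lt0n.
  rewrite /at_index; case: insubP => //= j _ ej.
  by rewrite /v_x /= hx // ej.
rewrite eN; congr (_ + _); apply/funext => k; rewrite /M.
have [k0|k0] := eqVneq (k : nat) 0%N.
  by rewrite /M_first /v_lam /= hl // k0.
have [kK|kK] := eqVneq k.+1 K.
  by rewrite /M_last /v_x /= hx // lt0n.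
by rewrite /M_mid /v_x /v_lam /= hx ?lt0n // hl // ltn_neqAle kK ltn_ord.
Qed.

End OptimalitySystem.

(* Main.v *)
Require Import Defs.
From mathcomp Require Import measurable_realfun lra.

(** Read row by row, (M + N) z = g says that on each subinterval the two
    differential equations hold, that x and lambda satisfy the boundary
    conditions at 0 and T, and that each auxiliary vector is both an end value
    of x or lambda on its own subinterval and the value of the neighbouring
    block at the same node.  Eliminating the auxiliary vectors leaves exactly
    the continuity of x and lambda across the nodes, and functions in H^1 (or
    L^2 with values in a domain) on adjacent intervals that agree at the common
    node glue to a function of the same class on the union.

    The finiteness of the L^2 norms is glued without measurability of
    [t |-> nrm (f t)]: the integral of a nonnegative function is the supremum
    over the simple functions below it, and in this form it is monotone up to
    null sets and subadditive in the domain for arbitrary functions. *)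

Set Implicit Arguments.
Unset Strict Implicit.
Unset Printing Implicit Defensive.

(** * Integrals of nonnegative functions as suprema over simple functions *)

Section LowerIntegral.
Context d (T : measurableType d) (R : realType).
Variable mu : {measure set T -> \bar R}.
Import HBNNSimple.
Local Open Scope ereal_scope.

Lemma ge0_integral_leP (f : T -> \bar R) (c : \bar R) :
  (forall x, 0 <= f x) ->
  (forall h : {nnsfun T >-> R},
     (forall x, (h x)%:E <= f x) -> \int[mu]_x (h x)%:E <= c) ->
  \int[mu]_x f x <= c.
Proof.
move=> f0 hc; rewrite ge0_integralTE//.
by apply: ge_ereal_sup => _ [h /= hf <-]; rewrite -integralT_nnsfun; exact: hc.
Qed.

Lemma ge0_nnsfun_le_integral (f : T -> \bar R) (h : {nnsfun T >-> R}) :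
  (forall x, (h x)%:E <= f x) -> \int[mu]_x (h x)%:E <= \int[mu]_x f x.
Proof.
move=> hf; have f0 x : 0 <= f x by apply: le_trans (hf x); rewrite lee_fin.
rewrite integralT_nnsfun ge0_integralTE//; apply: ereal_sup_ubound.
by exists h.
Qed.

(** Cutting a simple function off outside a measurable set leaves it simple, so the cut function can
    again compete in the supremum that defines the integral. *)
Lemma integral_nnsfun_patch (h : {nnsfun T >-> R}) (A : set T) :
  measurable A -> exists k : {nnsfun T >-> R},
    (forall x, k x = if x \in A then h x else 0%R) /\
    \int[mu]_(x in A) (h x)%:E = \int[mu]_x (k x)%:E.
Proof.
move=> mA; exists (proj_nnsfun h mA).
have kE x : proj_nnsfun h mA x = if x \in A then h x else 0%R.
  by rewrite -mrestrict patchE.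
split=> //; rewrite integral_mkcond; apply: eq_integral => x _.
by rewrite patchE kE; case: ifP.
Qed.

(** A simple function below [f] keeps its integral when set to zero on the null set [N] that
    contains all points where [f x <= g x] fails; after this cut it lies below [g] everywhere. *)
Lemma ge0_ae_le_integral (f g : T -> \bar R) :
  (forall x, 0 <= f x) -> (forall x, 0 <= g x) ->
  {ae mu, forall x, f x <= g x} -> \int[mu]_x f x <= \int[mu]_x g x.
Proof.
move=> f0 g0 [N [mN N0 fgN]]; apply: ge0_integral_leP => // h hf.
rewrite (ge0_negligible_integral mN)//; last first.
- by move=> x _; rewrite lee_fin.
- by apply/measurable_EFinP; exact: measurable_funTS.
have [k [kE ->]] := integral_nnsfun_patch h (measurableD measurableT mN).
apply: ge0_nnsfun_le_integral => x; rewrite kE; case: ifPn => [|_]; last first.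
  exact: g0.
rewrite inE => -[_ Nx]; apply: le_trans (hf x) _; apply: contrapT => fg.
by apply: Nx; apply: fgN.
Qed.

(** A simple function below [f] on the union splits along [A] and its complement. The first piece
    lies below [f] on [A]; the second lies below [f] on [B], since off [A] the union is just [B]. *)
Lemma ge0_integral_setU_le (A B : set T) (f : T -> \bar R) :
  measurable A -> (forall x, 0 <= f x) ->
  \int[mu]_(x in A `|` B) f x <= \int[mu]_(x in A) f x + \int[mu]_(x in B) f x.
Proof.
move=> mA f0.
have p0 D x : 0 <= (f \_ D) x by rewrite patchE; case: ifP.
rewrite integral_mkcond; apply: ge0_integral_leP => // h hf.
rewrite -(setUv A) ge0_integral_setU//; last 4 first.
- exact: measurableC.
- by rewrite setUv; apply/measurable_EFinP.
- by move=> x _; rewrite lee_fin.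
- by rewrite disj_set2E setICr.
have [k [kE ->]] := integral_nnsfun_patch h mA.
have [k' [kE' ->]] := integral_nnsfun_patch h (measurableC mA).
rewrite [leRHS]addeC [leLHS]addeC [\int[mu]_(x in A) f x]integral_mkcond.
rewrite [\int[mu]_(x in B) f x]integral_mkcond.
apply: leeD; apply: ge0_nnsfun_le_integral => x; rewrite patchE.
  rewrite kE'; case: ifPn => [|_]; last by case: ifP.
  rewrite inE => nAx; have := hf x; rewrite patchE in_setU.
  by rewrite (_ : (x \in A) = false)//; apply/negbTE; rewrite notin_setE.
rewrite kE; case: ifPn => // Ax; have := hf x.
by rewrite patchE in_setU Ax.
Qed.

End LowerIntegral.

(** * Almost everywhere statements on compact intervals *)

Section AlmostEverywhereOn.
Variable R : realType.
Implicit Types (l m r : R) (P Q : R -> Prop).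
Local Notation mu := (@lebesgue_measure R).

Let ae_filter : Filter (almost_everywhere mu).
Proof. exact: ae_filter_ringOfSetsType. Qed.

(** The two end points form a null set. Hence almost everywhere claims need checking only at
    interior points, where neighbourhoods inside the interval exist. *)
Lemma ae_on_itvoo l r : ae_on l r (fun s => l < s < r).
Proof.
exists ([set l] `|` [set r]); split.
- by apply: measurableU; exact: measurable_set1.
- by rewrite measureU0//; exact: lebesgue_measure_set1.
- move=> s /= /not_implyP[]; rewrite in_itv/= => /andP[ls sr] /negP.
  rewrite !lt_neqAle ls sr !andbT negb_and !negbK => /orP[]/eqP; last by right.
  by left.
Qed.

Lemma ae_onS l r P Q : (forall s, l < s < r -> P s -> Q s) ->
  ae_on l r P -> ae_on l r Q.
Proof.
move=> PQ; have := ae_on_itvoo l r; rewrite /ae_on.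
by apply: (@filterS2 _ _ ae_filter) => s ioo iP si; exact: PQ (ioo si) (iP si).
Qed.

Lemma ae_onI l r P Q : ae_on l r P -> ae_on l r Q ->
  ae_on l r (fun s => P s /\ Q s).
Proof.
rewrite /ae_on; apply: (@filterS2 _ _ ae_filter) => s Ps Qs lsr.
by split; [exact: Ps|exact: Qs].
Qed.

Lemma ae_onW l r P : (forall s, l < s < r -> P s) -> ae_on l r P.
Proof. by move=> H; apply: ae_onS (ae_on_itvoo l r) => s /H. Qed.

Lemma ae_on_sub l r l' r' P : l <= l' -> r' <= r ->
  ae_on l r P -> ae_on l' r' P.
Proof.
move=> ll rr; rewrite /ae_on; apply: (@filterS _ _ ae_filter) => s.
rewrite !in_itv/= => H /andP[ls sr].
by apply: H; rewrite (le_trans ll) ?(le_trans sr).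
Qed.

Lemma ae_on_cat l m r P : ae_on l m P -> ae_on m r P -> ae_on l r P.
Proof.
rewrite /ae_on; apply: (@filterS2 _ _ ae_filter) => s.
rewrite !in_itv/= => Pl Pr /andP[ls sr].
by have [sm|/ltW ms] := leP s m; [apply: Pl|apply: Pr]; rewrite ?ls ?sr ?sm ?ms.
Qed.

End AlmostEverywhereOn.

(** * Restriction and gluing in Bochner spaces *)

Section BochnerL2.
Variables (R : realType) (V : completeNormedModType R).
Implicit Types (l m r : R) (f g : R -> V) (D : set V) (nrm : V -> R).
Local Notation mu := (@lebesgue_measure R).

Lemma bochner_L2_ae_eq D nrm l r f g : ae_on l r (fun s => f s = g s) ->
  bochner_L2 D nrm l r f -> bochner_L2 D nrm l r g.
Proof.
move=> fg [[s [s_simple s_cvg]] f_fin]; split.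
  exists s; split=> //; apply: ae_onS (ae_onI fg s_cvg).
  by move=> x _ [<-].
apply: le_lt_trans f_fin.
rewrite integral_mkcond [leRHS]integral_mkcond; apply: ge0_ae_le_integral.
- by move=> x; rewrite patchE; case: ifP; rewrite ?lee_fin ?sqr_ge0.
- by move=> x; rewrite patchE; case: ifP; rewrite ?lee_fin ?sqr_ge0.
- move: fg; apply: (@filterS _ _ (ae_filter_ringOfSetsType mu)) => x fg.
  rewrite !patchE; case: ifPn => //; rewrite inE/= => /fg ->.
  exact: lexx.
Qed.

Lemma bochner_L2_sub D nrm l r l' r' f : l <= l' -> r' <= r ->
  bochner_L2 D nrm l r f -> bochner_L2 D nrm l' r' f.
Proof.
move=> ll rr [[s [s_simple s_cvg]] f_fin]; split.
  by exists s; split=> //; exact: ae_on_sub s_cvg.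
apply: le_lt_trans f_fin.
rewrite integral_mkcond [leRHS]integral_mkcond; apply: ge0_ae_le_integral.
- by move=> x; rewrite patchE; case: ifP; rewrite ?lee_fin ?sqr_ge0.
- by move=> x; rewrite patchE; case: ifP; rewrite ?lee_fin ?sqr_ge0.
- apply: aeW => x; rewrite !patchE; case: ifPn => [|_].
    rewrite inE/= in_itv/= => /andP[lx xr].
    by rewrite mem_set//= in_itv/= (le_trans ll)// (le_trans xr).
  by case: ifP; rewrite ?lee_fin ?sqr_ge0.
Qed.

Lemma simple_fun_glue m (s s' : R -> V) : simple_fun s -> simple_fun s' ->
  simple_fun (fun x => if x < m then s x else s' x).
Proof.
move=> [fs ms] [fs' ms']; split.
  apply: (@sub_finite_set _ _ (range s `|` range s')); last first.
    by rewrite finite_setU.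
  by move=> _ [x _ <-]; case: ifP => _; [left|right]; exists x.
move=> v; rewrite (_ : _ @^-1` _ =
    (`]-oo, m[ `&` s @^-1` [set v]) `|` (`[m, +oo[ `&` s' @^-1` [set v])).
  apply: measurableU; apply: measurableI.
  - exact: measurable_itv.
  - exact: ms.
  - exact: measurable_itv.
  - exact: ms'.
apply/seteqP; split=> x /=; rewrite !in_itv/= andbT.
  by case: ltP; [left|right].
by case: ltP => _ [[]|[]].
Qed.

(** The approximating simple functions are switched at [m], which keeps their values in [D];
    finiteness of the norm is subadditivity of the integral in the domain. *)
Lemma bochner_L2_cat D nrm l m r f : l <= m -> m <= r ->
  bochner_L2 D nrm l m f -> bochner_L2 D nrm m r f -> bochner_L2 D nrm l r f.
Proof.
move=> lm mr [[s [s_simple s_cvg]] f_fin] [[s' [s_simple' s_cvg']] f_fin'].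
split.
  exists (fun n x => if x < m then s n x else s' n x); split.
    move=> n; have [sn rn] := s_simple n; have [sn' rn'] := s_simple' n.
    split; first exact: simple_fun_glue.
    move=> _ [x _ <-]; case: ifP => _; [apply: rn|apply: rn']; by exists x.
  apply: (@ae_on_cat _ _ m).
    apply: ae_onS s_cvg => x /andP[_ xm] [Dx sx]; split=> //.
    by rewrite xm.
  apply: ae_onS s_cvg' => x /andP[mx _] [Dx sx]; split=> //.
  by rewrite ltNge (ltW mx).
have -> : [set` `[l, r]] = [set` `[l, m]] `|` [set` `[m, r]].
  apply/seteqP; split=> x /=; rewrite !in_itv/=.
    move=> /andP[lx xr]; have [xm|/ltW mx] := leP x m.
      by left; rewrite lx.
    by right; rewrite mx.
  move=> [] /andP[lx xr].
    by rewrite lx (le_trans xr).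
  by rewrite xr (le_trans lm).
apply: le_lt_trans (lte_add_pinfty f_fin f_fin').
apply: ge0_integral_setU_le => //.
by move=> x; rewrite lee_fin sqr_ge0.
Qed.

End BochnerL2.

(** * Absolute continuity and H^1 under restriction and gluing *)

Section Sobolev.
Variables (R : realType) (V : completeNormedModType R).
Implicit Types (l m r : R) (f g : R -> V).

Lemma eq_itv_near l r f g s : {in `[l, r], f =1 g} -> l < s < r ->
  \forall x \near s, f x = g x.
Proof.
move=> fg /andP[ls sr].
have /near_in_itvoo : s \in `]l, r[ by rewrite in_itv/= ls.
by apply: filterS => x xlr; apply: fg; exact: subset_itv_oo_cc xlr.
Qed.

(** At an interior point the two functions agree on a whole neighbourhood. At the end points their
    derivatives may differ, which is harmless almost everywhere. *)
Lemma eq_itv_derive1 l r f g s : {in `[l, r], f =1 g} -> l < s < r ->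
  derive1 f s = derive1 g s.
Proof.
by move=> fg lsr; rewrite !derive1E; apply/near_eq_derive/(eq_itv_near fg).
Qed.

Lemma eq_itv_abs_continuous l r f g : {in `[l, r], f =1 g} ->
  abs_continuous l r f -> abs_continuous l r g.
Proof.
move=> fg fac e /fac[d d0 fd]; exists d => // I Ilr Ipw Id.
apply: le_lt_trans (fd I Ilr Ipw Id); rewrite big_seq [leRHS]big_seq.
apply: ler_sum => p /(allP Ilr) /andP[/andP[lp pp] pr].
by rewrite !fg ?in_itv/= ?pr ?lp ?(le_trans pp) ?(le_trans lp).
Qed.

Lemma abs_continuous_sub l r l' r' f : l <= l' -> r' <= r ->
  abs_continuous l r f -> abs_continuous l' r' f.
Proof.
move=> ll rr fac e /fac[d d0 fd]; exists d => // I Ilr.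
apply: fd; apply: sub_all Ilr => p /andP[/andP[lp pp] pr].
by rewrite (le_trans ll)// pp (le_trans pr).
Qed.

Lemma abs_continuous_cat l m r f : l <= m -> m <= r ->
  abs_continuous l m f -> abs_continuous m r f -> abs_continuous l r f.
Proof.
move=> lm mr fl fr e e0; have e20 : 0 < e / 2 by rewrite divr_gt0.
have [d d0 fd] := fl _ e20; have [d' d'0 fd'] := fr _ e20.
exists (Num.min d d'); first by rewrite lt_min d0.
move=> I Ilr Ipw; rewrite lt_min => /andP[Id Id'].
(* Clipping at [m] sends the family into [[l, m]] and into [[m, r]]. It preserves the order and
   lengthens no interval, so both clipped families satisfy the length bounds. *)
pose Il := [seq (Num.min p.1 m, Num.min p.2 m) | p <- I].
pose Ir := [seq (Num.max p.1 m, Num.max p.2 m) | p <- I].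
have Ip p : p \in I -> [/\ l <= p.1, p.1 <= p.2 & p.2 <= r].
  by move=> /(allP Ilr)/andP[/andP[]].
have fIl : \sum_(p <- Il) `|f p.2 - f p.1| < e / 2.
  apply: fd.
  - apply/allP => _ /mapP[p /Ip[lp pp pr] ->] /=.
    by rewrite le_min lp lm le_min2// ge_min lexx orbT.
  - rewrite pairwise_map; apply: sub_pairwise Ipw => p q pq /=.
    by rewrite le_min2.
  - rewrite big_map; apply: le_lt_trans Id; rewrite big_seq [leRHS]big_seq.
    apply: ler_sum => p /Ip[lp pp pr] /=.
    by rewrite /Num.min; do 2 case: ifPn; lra.
have fIr : \sum_(p <- Ir) `|f p.2 - f p.1| < e / 2.
  apply: fd'.
  - apply/allP => _ /mapP[p /Ip[lp pp pr] ->] /=.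
    by rewrite le_max lexx orbT le_max2// ge_max pr mr.
  - rewrite pairwise_map; apply: sub_pairwise Ipw => p q pq /=.
    by rewrite le_max2.
  - rewrite big_map; apply: le_lt_trans Id'; rewrite big_seq [leRHS]big_seq.
    apply: ler_sum => p /Ip[lp pp pr] /=.
    by rewrite /Num.max; do 2 case: ifPn; lra.
rewrite (splitr e); apply: le_lt_trans (ltrD fIl fIr).
rewrite !big_map -big_split/= big_seq [leRHS]big_seq.
apply: ler_sum => p /Ip[lp pp pr] /=.
(* An interval on one side of [m] collapses to a point in the other family; one that straddles [m]
   is handled by the triangle inequality through [f m]. *)
have [p2m|mp2] := leP p.2 m.
  have p1m := le_trans pp p2m.
  by rewrite min_l// max_r// subrr normr0 addr0.
have [p1m|mp1] := leP p.1 m.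
  by rewrite -(subrKA (f m)) addrC ler_normD.
by rewrite subrr normr0 add0r.
Qed.

Lemma H1_sub l r l' r' f : l <= l' -> r' <= r -> H1 l r f -> H1 l' r' f.
Proof.
move=> ll rr [L2f acf df L2df]; split.
- exact: bochner_L2_sub L2f.
- exact: abs_continuous_sub acf.
- exact: ae_on_sub df.
- exact: bochner_L2_sub L2df.
Qed.

(** Both halves refer to the same pointwise derivative [derive1 f], and a failure of derivability at
    the single point [m] is absorbed by the null sets. *)
Lemma H1_cat l m r f : l <= m -> m <= r -> H1 l m f -> H1 m r f -> H1 l r f.
Proof.
move=> lm mr [L2f acf df L2df] [L2f' acf' df' L2df']; split.
- exact: bochner_L2_cat L2f L2f'.
- exact: abs_continuous_cat acf acf'.
- exact: ae_on_cat df df'.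
- exact: bochner_L2_cat L2df L2df'.
Qed.

Lemma eq_itv_bochner_L2 D nrm l r f g : {in `[l, r], f =1 g} ->
  bochner_L2 D nrm l r f -> bochner_L2 D nrm l r g.
Proof.
move=> fg; apply: bochner_L2_ae_eq; apply: ae_onW => s /andP[ls sr].
by apply: fg; rewrite in_itv/= !ltW.
Qed.

Lemma eq_itv_H1 l r f g : {in `[l, r], f =1 g} -> H1 l r f -> H1 l r g.
Proof.
move=> fg [L2f acf df L2df]; split.
- exact: eq_itv_bochner_L2 L2f.
- exact: eq_itv_abs_continuous acf.
- apply: ae_onS df => s lsr; apply: near_eq_derivable; exact: eq_itv_near lsr.
- apply: bochner_L2_ae_eq L2df; apply: ae_onW => s; exact: eq_itv_derive1.
Qed.

End Sobolev.

(** * The time grid and the concatenation of blocks *)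

Section Grid.
Variables (R : realType) (X : hilbertType R) (K : nat) (t : nat -> R).
Hypothesis t_incr : forall k, (k < K)%N -> t k < t k.+1.

Lemma grid_le i j : (i <= j <= K)%N -> t i <= t j.
Proof.
move=> /andP[]; elim: j => [|j IHj]; first by rewrite leqn0 => /eqP ->.
rewrite leq_eqVlt ltnS => /predU1P[->//|ij] jK.
by rewrite (le_trans (IHj ij (ltnW jK)))// ltW// t_incr.
Qed.

(** Carries a property of intervals that survives joining, such as regularity or a differential
    equation, from the subintervals to the whole time interval. *)
Lemma grid_ind (P : R -> R -> Prop) :
  (forall l m r, l <= m -> m <= r -> P l m -> P m r -> P l r) ->
  (forall k : 'I_K, P (t k) (t k.+1)) ->
  (0 < K)%N -> P (t 0%N) (t K).
Proof.
move=> P_cat P_step K0.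
(* The induction starts at the first subinterval, because nothing is assumed about degenerate
   intervals. *)
suff H n : (n < K)%N -> P (t 0%N) (t n.+1).
  by rewrite -(prednK K0); apply: H; rewrite prednK.
elim: n => [|n IHn] nK; first exact: (P_step (Ordinal nK)).
apply: (P_cat _ (t n.+1)).
- by apply: (@grid_le 0 n.+1); exact: ltnW nK.
- by rewrite ltW ?t_incr.
- exact/IHn/ltnW.
- exact: (P_step (Ordinal nK)).
Qed.

Lemma grid_itv_inj (i j : 'I_K) s :
  t i <= s < t i.+1 -> t j <= s < t j.+1 -> i = j.
Proof.
wlog ij : i j / (i <= j)%N => [H|] si sj.
  by have [/H|/ltnW/H H'] := leqP i j; [apply|apply/esym/H'].
apply/val_inj/eqP => /=; rewrite eqn_leq ij leqNgt; apply/negP => lij.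
have : t i.+1 <= t j by rewrite grid_le// lij ltnW.
by case/andP: si sj => _ si /andP[sj _]; rewrite leNgt (le_lt_trans sj).
Qed.

Lemma concat_itvco (f : Zblock X -> R -> X) (z : Zspace X K) (k : 'I_K) s :
  t k <= s < t k.+1 -> concat t f z s = f (z k) s.
Proof.
move=> ks; rewrite /concat; case: pickP => [j|/(_ k)]; last by rewrite ks.
case/orP=> [js|/andP[_ /eqP sT]]; first by rewrite (grid_itv_inj js ks).
have : t k.+1 <= t K by rewrite grid_le ?leqnn ?andbT.
by rewrite leNgt -sT; case/andP: ks => _ ->.
Qed.

Lemma concat_last (f : Zblock X -> R -> X) (z : Zspace X K) (k : 'I_K) :
  k.+1 = K -> concat t f z (t K) = f (z k) (t K).
Proof.
move=> kK; rewrite /concat; case: pickP => [j|/(_ k)]; last first.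
  by rewrite kK !eqxx orbT.
case/orP=> [/andP[_]|/andP[/eqP jK _]]; last first.
  by congr (f (z _) _); apply/val_inj/succn_inj; rewrite kK.
by rewrite ltNge grid_le ?leqnn ?andbT.
Qed.

Lemma concat_itvcc (f : Zblock X -> R -> X) (z : Zspace X K) :
  (forall i j : 'I_K, j = i.+1 :> nat -> f (z i) (t j) = f (z j) (t j)) ->
  forall k : 'I_K, {in `[t k, t k.+1], f (z k) =1 concat t f z}.
Proof.
move=> f_match k s; rewrite in_itv/= => /andP[ks].
rewrite le_eqVlt => /predU1P[->|sk]; last by rewrite (@concat_itvco _ _ k) ?ks.
(* At the right end [concat] already reads the next block, unless this block is the last one;
   matching values at the node close the gap. *)
have [kK|] := eqVneq k.+1 K; first by rewrite kK (concat_last _ _ kK).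
rewrite neq_ltn [(K < _)%N]ltnNge ltn_ord orbF => kK.
rewrite (@concat_itvco _ _ (Ordinal kK)) ?lexx ?t_incr//.
exact: (f_match k (Ordinal kK)).
Qed.

End Grid.

(** * The rows of the block equation *)

Section MN.
Variables (R : realType) (X U Y : hilbertType R).
Variables (A : operator X X) (B : U -> X) (C : X -> Y).
Variables (yref : R -> Y) (x0 : X) (K : nat) (t : nat -> R).
Local Notation Cs := (adjoint (everywhere C)).
Local Notation MN z := (M A B C t z + N z).
Implicit Type z : Zspace X K.

Lemma at_index_ord (f : 'I_K -> X) (i : 'I_K) : at_index f i = f i.
Proof. by rewrite /at_index valK. Qed.

(** With at least two blocks none is both first and last, so the three shapes of [M] merge into one
    formula with a separate case distinction for each end. *)
Lemma MN_blockE z (k : 'I_K) : (1 < K)%N -> MN z k =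
  ((M_fun1 A C (z k),
    - fun_lam (z k) (t k.+1) + if k.+1 == K then 0 else v_lam (z k)),
   (M_fun2 A B (z k),
    fun_x (z k) (t k) - if k == 0 :> nat then 0 else v_x (z k)),
   if k == 0 :> nat then 0
   else fun_lam (z k) (t k) - at_index (@v_lam R X \o z) k.-1,
   if k.+1 == K then 0
   else at_index (@v_x R X \o z) k.+1 - fun_x (z k) (t k.+1)).
Proof.
move=> K1.
have addE (b b' : Zblock X) : b + b' =
    ((b.1.1.1.1 + b'.1.1.1.1, b.1.1.1.2 + b'.1.1.1.2),
     (b.1.1.2.1 + b'.1.1.2.1, b.1.1.2.2 + b'.1.1.2.2),
     b.1.2 + b'.1.2, b.2 + b'.2) by [].
have -> : MN z k = M A B C t z k + N z k by [].
rewrite /M; have [k0|k0] := eqVneq (k : nat) 0%N.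
  rewrite ltn_eqF ?k0// addE/= k0/= !addr0 subr0; congr (_, _).
  by rewrite addrC.
have [kK|kK] := eqVneq k.+1 K; rewrite addE/= (negbTE k0) !addr0//.
  (* For the last block the index [K] is out of range, and [at_index] returns its default 0. *)
  congr (_, _); rewrite /at_index insubF ?addr0// kK ltnn //.
by congr (_, _); rewrite addrC.
Qed.

(** The first two entries of a row concern one block only: they give the differential equations and
    the end values. The last two couple neighbouring blocks and give the links. *)
Lemma solves_MNP z : (1 < K)%N -> solves_MN A B C yref x0 t z <-> [/\
  dom_M A t z,
  (forall k : 'I_K,
    [/\ ae_on (t k) (t k.+1) (fun s => M_fun1 A C (z k) s = - Cs (yref s)),
        ae_on (t k) (t k.+1) (fun s => M_fun2 A B (z k) s = 0),
        (if k == 0 :> nat then x0 else v_x (z k)) = fun_x (z k) (t k) &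
        (if k.+1 == K then 0 else v_lam (z k)) = fun_lam (z k) (t k.+1)]) &
  (forall i j : 'I_K, j = i.+1 :> nat ->
    v_x (z j) = fun_x (z i) (t j) /\ v_lam (z i) = fun_lam (z j) (t j))].
Proof.
move=> K1; split=> [[domz MNz]|[domz rows links]].
  split=> // [k|i j ij].
    have := MNz k; rewrite MN_blockE// => -[/= e1 d1 e2 d2 _]; split=> //.
    - by apply/esym; move: d2; case: ifP => _; rewrite ?subr0// => /subr0_eq.
    - by move: d1 ; rewrite addrC => /subr0_eq.
  have iK : i.+1 == K = false by rewrite -ij ltn_eqF.
  (* The third entry of row [j] links [v_lam (z i)], the fourth entry of row [i] links
     [v_x (z j)]. *)
  have := MNz j; rewrite MN_blockE// ij/= => -[_ _ _ _ [/= + _]].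
  rewrite at_index_ord/= => /subr0_eq jl.
  have := MNz i; rewrite MN_blockE// iK => -[_ _ _ _ [_ /=]].
  rewrite -ij at_index_ord/= => /subr0_eq ix.
  by split=> //; rewrite ij.
split=> // k; have [e1 e2 xk lk] := rows k; rewrite MN_blockE//; split=> //=.
- by rewrite lk addNr.
- by rewrite -xk; case: ifP => _; rewrite ?subr0 ?subrr.
split.
  rewrite {1}/v_x /=; case: ifPn => //; rewrite -lt0n => k0.
  have kK : (k.-1 < K)%N by apply: leq_ltn_trans (ltn_ord k); exact: leq_pred.
  have [_ vl] := links (Ordinal kK) k (esym (prednK k0)).
  have /= -> := at_index_ord (@v_lam R X \o z) (Ordinal kK).
  by rewrite vl subrr.
case: ifPn => // kK'.
have kK : (k.+1 < K)%N by rewrite ltn_neqAle kK' ltn_ord.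
have [vx _] := links k (Ordinal kK) erefl.
have /= -> := at_index_ord (@v_x R X \o z) (Ordinal kK).
by rewrite vx subrr.
Qed.

End MN.

(** * Equivalence of the block equation and the optimality system *)

Theorem proposition3 (R : realType) (X U Y : hilbertType R)
    (A : operator X X) (B : {linear U -> X}) (C : {linear X -> Y})
    (T : R) (yref : R -> Y) (x0 : X) (K : nat) (t : nat -> R)
    (hA : generates_C0_semigroup A)
    (hB : continuous (B : U -> X)) (hC : continuous (C : X -> Y))
    (hT : 0 < T) (hyref : L2 0 T yref)
    (hK : (2 <= K)%N) (ht0 : t 0%N = 0) (htK : t K = T)
    (ht : forall k : nat, (k < K)%N -> t k < t k.+1) :
  (forall z : Zspace X K,
      solves_MN A B C yref x0 t z ->
      weak_solution A B C yref x0 T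
        (concat t (@fun_x R X) z) (concat t (@fun_lam R X) z)) /\
  (forall x lam : R -> X,
      weak_solution A B C yref x0 T x lam ->
      exists vx vl : 'I_K -> X,
        solves_MN A B C yref x0 t (restrict t x lam vx vl) /\
        (forall vx' vl' : 'I_K -> X,
            solves_MN A B C yref x0 t (restrict t x lam vx' vl') ->
            (forall k : 'I_K, (0 < k)%N -> vx' k = vx k) /\
            (forall k : 'I_K, (k.+1 < K)%N -> vl' k = vl k))).
Proof.
have K0 : (0 < K)%N by exact: ltnW hK.
have t_ge0 k : (k <= K)%N -> 0 <= t k by move=> kK; rewrite -ht0 (grid_le ht).
have t_leT k : (k <= K)%N -> t k <= T.
  by move=> kK; rewrite -htK (grid_le ht)// kK leqnn.
split=> [z /(solves_MNP A B C yref x0 t z hK)[domz rows links]|x lam].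
  have dom_x (k : 'I_K) : H1 (t k) (t k.+1) (fun_x (z k)) /\
      L2_dom A (t k) (t k.+1) (fun_x (z k)).
    by have [x [lam [vx [vl [-> ? ?]]]]] := domz k.
  have dom_lam (k : 'I_K) : H1 (t k) (t k.+1) (fun_lam (z k)) /\
      L2_dom (adjoint A) (t k) (t k.+1) (fun_lam (z k)).
    by have [x [lam [vx [vl [-> ? ?]]]]] := domz k.
  (* At the node between blocks [i] and [j], [v_x (z j)] equals the value of [x] from both sides;
     for [lam] the vector [v_lam (z i)] does the same. *)
  have xE (k : 'I_K) :
      {in `[t k, t k.+1], fun_x (z k) =1 concat t (@fun_x R X) z}.
    apply: concat_itvcc => // i j ij; have [<- _] := links i j ij.
    by have [_ _ + _] := rows j; rewrite ij.
  have lamE (k : 'I_K) :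
      {in `[t k, t k.+1], fun_lam (z k) =1 concat t (@fun_lam R X) z}.
    apply: concat_itvcc => // i j ij; have [_ <-] := links i j ij.
    by have [_ _ _] := rows i; rewrite -ij ltn_eqF.
  have itvW (k : 'I_K) s : t k < s < t k.+1 -> s \in `[t k, t k.+1].
    by move=> /andP[? ?]; rewrite in_itv/= !ltW.
  (* The bounds 0 and [T] become grid nodes, so that [grid_ind] applies. *)
  rewrite /weak_solution -ht0 -htK; split; split.
  - apply: (grid_ind ht (P := fun l r => H1 l r _)) => // [l m r|k].
      exact: H1_cat.
    exact: (eq_itv_H1 (xE k) (dom_x k).1).
  - apply: (grid_ind ht (P := fun l r => L2_dom A l r _)) => // [l m r|k].
      exact: bochner_L2_cat.
    exact: (eq_itv_bochner_L2 (xE k) (dom_x k).2).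
  - apply: (grid_ind ht (P := fun l r => H1 l r _)) => // [l m r|k].
      exact: H1_cat.
    exact: (eq_itv_H1 (lamE k) (dom_lam k).1).
  - apply: (grid_ind ht (P := fun l r => L2_dom (adjoint A) l r _)) =>
      // [l m r|k].
      exact: bochner_L2_cat.
    exact: (eq_itv_bochner_L2 (lamE k) (dom_lam k).2).
  - apply: (grid_ind ht (P := fun l r => ae_on l r _)) => // [l m r _ _|k].
      exact: ae_on_cat.
    have [_ + _ _] := rows k; apply: ae_onS => s sk; rewrite /M_fun2.
    rewrite (eq_itv_derive1 (xE k) sk) xE ?itvW// lamE ?itvW//.
    by rewrite -addrA -opprD => /subr0_eq.
  - rewrite -(xE (Ordinal K0)) ?in_itv//=; last by rewrite lexx ltW// ht.
    by have [_ _ /= <- _] := rows (Ordinal K0).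
  - apply: (grid_ind ht (P := fun l r => ae_on l r _)) => // [l m r _ _|k].
      exact: ae_on_cat.
    have [+ _ _ _] := rows k; apply: ae_onS => s sk; rewrite /M_fun1.
    rewrite (eq_itv_derive1 (lamE k) sk) xE ?itvW// lamE ?itvW// => <-.
    by rewrite -!addrA addNKr addrC addrK.
  - have kK : (K.-1 < K)%N by rewrite prednK.
    have [_ _ _ /=] := rows (Ordinal kK); rewrite prednK// eqxx htK => ->.
    by rewrite -htK (@concat_last _ _ _ _ ht _ _ (Ordinal kK)) //= prednK.
move=> [[H1x domx] [H1lam domlam] [odex x_init] [odelam lam_fin]].
(* These end values are what the point parts of each row demand; the links then hold because
   neighbouring blocks restrict the same [x] and [lam]. *)
exists (fun k => x (t k)), (fun k => lam (t k.+1)); split.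
  apply/solves_MNP => //; split=> [k|k|i j ij].
  - exists x, lam, (x (t k)), (lam (t k.+1)).
    have l0 := t_ge0 k (ltnW (ltn_ord k)); have rT := t_leT k.+1 (ltn_ord k).
    split=> //; split.
    + exact: H1_sub H1x.
    + exact: bochner_L2_sub domx.
    + exact: H1_sub H1lam.
    + exact: bochner_L2_sub domlam.
  - have l0 := t_ge0 k (ltnW (ltn_ord k)); have rT := t_leT k.+1 (ltn_ord k).
    rewrite /fun_x /fun_lam /v_x /v_lam /=; split.
    + apply: ae_onS (ae_on_sub l0 rT odelam) => s _.
      rewrite /M_fun1 /fun_x /fun_lam /= => ->.
      by rewrite -!addrA [X in _ + X]addrCA addKr addrCA addNr addr0.
    + apply: ae_onS (ae_on_sub l0 rT odex) => s _.
      rewrite /M_fun2 /fun_x /fun_lam /= => ->.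
      by rewrite -addrA -opprD subrr.
    + by case: eqP => // ->; rewrite ht0.
    + by case: eqP => // ->; rewrite htK.
  - by rewrite /fun_x /fun_lam /v_x /v_lam /= ij.
(* Uniqueness: the point parts of the rows determine [vx'] on every block after the first and [vl']
   on every block before the last. *)
move=> vx' vl' /(solves_MNP A B C yref x0 t _ hK)[_ rows _]; split=> k k_in.
  by have [_ _ + _] := rows k; rewrite gtn_eqF.
by have [_ _ _] := rows k; rewrite ltn_eqF.
Qed.
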